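(* Let $Q\ge2$, $\kappa\ge1$, and let $\mathbf p_{ql}=\mathbf p_{lq}=(p_{ql}(1),\dots,p_{ql}(\kappa))$, $1\le q\le l\le Q$, be probability vectors that are linearly independent in $\mathbb R^\kappa$. Let $A$ be the $Q^3\times\kappa^3$ matrix with rows indexed by $(z_1,z_2,z_3)\in\{1,\dots,Q\}^3$, columns indexed by $(x_{12},x_{13},x_{23})\in\{1,\dots,\kappa\}^3$, and entries $$A_{(z_1,z_2,z_3),(x_{12},x_{13},x_{23})}=p_{z_1z_2}(x_{12})\,p_{z_1z_3}(x_{13})\,p_{z_2z_3}(x_{23}).$$ Then $A$ has full row rank $Q^3$.
   Context: In the $\kappa$-state random graph mixture model, $A$ is the matrix of conditional probabilities of the edge states on the complete graph on $3$ nodes given the latent groups of the $3$ nodes, with $p_{ql}(k)=\mathbb P(X_{ij}=k\mid Z_i=q,Z_j=l)$. *)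

(* Defs.v *)
From HB Require Import structures.
From mathcomp Require Import all_boot all_order all_algebra.
Set Implicit Arguments. Unset Strict Implicit. Unset Printing Implicit Defensive.
Import Order.TTheory GRing.Theory Num.Theory.
Local Open Scope ring_scope.

(* Node groups are 'I_Q (i.e. {1..Q} shifted to {0..Q-1}), edge states 'I_k.
   p q l x = p_{ql}(x). *)

Definition pvec (R : nzRingType) (Q k : nat) (p : 'I_Q -> 'I_Q -> 'I_k -> R)
  (q l : 'I_Q) : 'rV[R]_k := \row_x p q l x.

Definition edge_prob_family (R : nzRingType) (Q k : nat) (p : 'I_Q -> 'I_Q -> 'I_k -> R)
  : seq 'rV[R]_k :=
  [seq pvec p ql.1 ql.2 | ql <- enum [pred ql : 'I_Q * 'I_Q | (ql.1 <= ql.2)%N]].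

Definition prob_vec (R : numDomainType) (k : nat) (v : 'I_k -> R) : Prop :=
  (forall x, 0 <= v x) /\ \sum_x v x = 1.

Definition Amx (R : nzRingType) (Q k : nat) (p : 'I_Q -> 'I_Q -> 'I_k -> R)
  : 'M[R]_(#|{: 'I_Q * 'I_Q * 'I_Q}|, #|{: 'I_k * 'I_k * 'I_k}|) :=
  \matrix_(i, j)
    let: (z1, z2, z3) := enum_val i in
    let: (x12, x13, x23) := enum_val j in
    p z1 z2 x12 * p z1 z3 x13 * p z2 z3 x23.

(* Main.v *)
Require Import Defs.
From HB Require Import structures.
From mathcomp Require Import all_boot all_order all_algebra.
Set Implicit Arguments. Unset Strict Implicit. Unset Printing Implicit Defensive.
Import Order.TTheory GRing.Theory Num.Theory.
Local Open Scope ring_scope.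

(* Linear independence of the vectors p_{ql} gives a matrix D with
   sum_x p_{ql}(x) D_x(q'l') = [{q,l} = {q',l'}].  Then
   B_{(x12,x13,x23),(w1,w2,w3)} = D_{x12}(w1w2) D_{x13}(w1w3) D_{x23}(w2w3)
   is a right inverse of A: the product factors into three such sums, and the
   three unordered pairs {z1,z2}, {z1,z3}, {z2,z3} determine the ordered
   triple (z1,z2,z3). *)

Lemma free_row_free (R : fieldType) (k : nat) (s : seq 'rV[R]_k) :
  free s -> row_free (\matrix_(i < size s) s`_i).
Proof.
move=> free_s; rewrite -kermx_eq0; apply/rowV0P => v /sub_kermxP vM0.
move: free_s; rewrite -[s]/(tval (in_tuple s)) => /freeP/(_ (fun i => v 0 i)).
move=> coef0; apply/rowP => j; rewrite [RHS]mxE; apply: coef0.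
by rewrite -[RHS]vM0 mulmx_sum_row; apply: eq_bigr => i _; rewrite rowK.
Qed.

Lemma sum_triple_mul (R : comNzRingType) (I J K : finType)
    (f : I -> R) (g : J -> R) (h : K -> R) :
  \sum_(t : I * J * K) f t.1.1 * g t.1.2 * h t.2 =
  (\sum_i f i) * (\sum_j g j) * (\sum_l h l).
Proof.
rewrite big_distrlr pair_bigA big_distrlr pair_bigA /=.
by apply: eq_bigr => -[[i j] l].
Qed.

Section Kron3Rows.
Variables (R : fieldType) (n k m : nat) (M : 'M[R]_(n, k)).
Variable e : 'I_m -> 'I_n * 'I_n * 'I_n.

Definition kron3_rows : 'M[R]_(m, #|{: 'I_k * 'I_k * 'I_k}|) :=
  \matrix_(i, j) let x := enum_val j in
    M (e i).1.1 x.1.1 * M (e i).1.2 x.1.2 * M (e i).2 x.2.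

Lemma row_free_kron3_rows : row_free M -> injective e -> row_free kron3_rows.
Proof.
move=> /row_freeP[D MD] e_inj; apply/row_freeP.
exists (\matrix_(j, i') let x := enum_val j in
          D x.1.1 (e i').1.1 * D x.1.2 (e i').1.2 * D x.2 (e i').2).
apply/matrixP => i i'; rewrite !mxE.
have MDE a a' : \sum_x M a x * D x a' = (a == a')%:R.
  by move/matrixP/(_ a a'): MD; rewrite !mxE.
rewrite (reindex (@enum_rank _)) /=; last exact/onW_bij/enum_rank_bij.
under eq_bigr => x _ do
  rewrite !mxE enum_rankK mulrACA [X in X * _]mulrACA.
rewrite (sum_triple_mul (fun a => M (e i).1.1 a * D a (e i').1.1)
  (fun b => M (e i).1.2 b * D b (e i').1.2) (fun c => M (e i).2 c * D c (e i').2)).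
rewrite !MDE -!natrM !mulnb -!xpair_eqE -!surjective_pairing.
by rewrite (inj_eq e_inj).
Qed.

End Kron3Rows.

Definition sort_pair (d : Order.disp_t) (T : orderType d) (x y : T) :=
  if (x <= y)%O then (x, y) else (y, x).

Lemma sort_pair_eq (d : Order.disp_t) (T : orderType d) (a b a' b' : T) :
  sort_pair a b = sort_pair a' b' -> a = a' /\ b = b' \/ a = b' /\ b = a'.
Proof.
by rewrite /sort_pair; case: leP => _; case: leP => _ [-> ->]; auto.
Qed.

Lemma sort_pair_triangle_inj (d : Order.disp_t) (T : orderType d)
    (a b c a' b' c' : T) :
  sort_pair a b = sort_pair a' b' -> sort_pair a c = sort_pair a' c' ->
  sort_pair b c = sort_pair b' c' -> (a, b, c) = (a', b', c').
Proof.
move=> /sort_pair_eq[[? ?]|[? ?]] /sort_pair_eq[[? ?]|[? ?]]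
  /sort_pair_eq[[? ?]|[? ?]]; subst; congruence.
Qed.

Section EdgeIndex.
Variables (R : nzRingType) (Q k : nat) (p : 'I_Q -> 'I_Q -> 'I_k -> R).

Let edges := enum [pred ql : 'I_Q * 'I_Q | (ql.1 <= ql.2)%N].

Lemma sort_pair_in_edges (q l : 'I_Q) : sort_pair q l \in edges.
Proof. by rewrite mem_enum inE /sort_pair; case: leP => //= /ltnW. Qed.

Lemma edge_index_subproof (q l : 'I_Q) :
  (index (sort_pair q l) edges < size (edge_prob_family p))%N.
Proof. by rewrite size_map index_mem sort_pair_in_edges. Qed.

Definition edge_index (q l : 'I_Q) : 'I_(size (edge_prob_family p)) :=
  Ordinal (edge_index_subproof q l).

Lemma edge_index_eq (q l q' l' : 'I_Q) :
  edge_index q l = edge_index q' l' -> sort_pair q l = sort_pair q' l'.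
Proof.
move/(congr1 val) => /= eq_index.
by rewrite -(nth_index (q, q) (sort_pair_in_edges q l)) eq_index
  nth_index ?sort_pair_in_edges.
Qed.

Lemma nth_edge_index (q l : 'I_Q) : (forall q l, p q l = p l q) ->
  (edge_prob_family p)`_(edge_index q l) = pvec p q l.
Proof.
move=> psym; rewrite (nth_map (q, l)) ?index_mem ?sort_pair_in_edges //.
rewrite nth_index ?sort_pair_in_edges // /sort_pair.
by case: (leP q l); rewrite /pvec // psym.
Qed.

End EdgeIndex.

Theorem lemma5 (R : realFieldType) (Q k : nat) (p : 'I_Q -> 'I_Q -> 'I_k -> R)
  (hQ : (2 <= Q)%N) (hk : (1 <= k)%N)
  (hsym : forall q l, p q l = p l q)
  (hprob : forall q l, prob_vec (p q l))
  (hfree : free (edge_prob_family p)) :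
  \rank (Amx p) = (Q ^ 3)%N.
Proof.
pose s := edge_prob_family p.
pose M := \matrix_(i < size s) s`_i.
pose e (i : 'I_#|{: 'I_Q * 'I_Q * 'I_Q}|) := let: (z1, z2, z3) := enum_val i in
  (edge_index p z1 z2, edge_index p z1 z3, edge_index p z2 z3).
have e_inj : injective e.
  move=> i i'; rewrite /e => eq_e; apply: enum_val_inj; move: eq_e.
  case: (enum_val i) => [[z1 z2] z3]; case: (enum_val i') => [[w1 w2] w3].
  move/eqP; rewrite !xpair_eqE => /andP[/andP[/eqP e12 /eqP e13] /eqP e23].
  exact: sort_pair_triangle_inj (edge_index_eq e12) (edge_index_eq e13)
    (edge_index_eq e23).
have -> : Amx p = kron3_rows M e.
  apply/matrixP => i j; rewrite !mxE /e.
  case: (enum_val i) => [[z1 z2] z3]; case: (enum_val j) => [[x12 x13] x23].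
  by rewrite /M !mxE !nth_edge_index // !mxE.
have /eqP -> := row_free_kron3_rows (free_row_free hfree) e_inj.
by rewrite !card_prod card_ord !expnS expn0 muln1 mulnA.
Qed.
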